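(* Let $p$ be a prime and $q=p^f$. For $q>5$, the group $\mathrm{GL}(n,\overline{\mathbb{F}_q})$ is not acceptable for all $n\in\mathbb{N}$ (that is, for every $n\in\mathbb{N}$ the group is not acceptable).
   Context: $\overline{\mathbb{F}_q}$ denotes an algebraic closure of the finite field $\mathbb{F}_q$ with $q$ elements, and $\mathrm{GL}(n,\overline{\mathbb{F}_q})$ is the group of invertible $n\times n$ matrices over it. Let $\Gamma$ be a group and $H$ a finite group. Two homomorphisms $\phi_1,\phi_2:H\to\Gamma$ are element-conjugate if for every $x\in H$ there is $h(x)\in\Gamma$ with $\phi_1(x)=h(x)^{-1}\phi_2(x)h(x)$; they are globally conjugate if one can choose a single $h\in\Gamma$ with $\phi_1(x)=h^{-1}\phi_2(x)h$ for all $x\in H$. The group $\Gamma$ is acceptable if for every finite group $H$, any two element-conjugate homomorphisms $H\to\Gamma$ are globally conjugate.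
   Formalization: The formal statement requires n ≥ 2 in place of ''for all n in N'': for n = 1 the group GL(1) over the algebraic closure is abelian, so element-conjugate homomorphisms coincide and the group is acceptable (for n = 0 it is trivial). *)

(* Defs.v *)
From HB Require Import structures.
From mathcomp Require Import all_boot all_order all_fingroup all_algebra all_field.

Set Implicit Arguments.
Unset Strict Implicit.
Unset Printing Implicit Defensive.

Section GeneralLinearGroup.

Local Open Scope ring_scope.

Variables (n : nat) (K : fieldType).

(* The library's {'GL_n[R]} is restricted to finite rings R (and to n > 0),
   hence this version for an arbitrary field. *)
Record gl := GLmx { gl_val :> 'M[K]_n; gl_unit : gl_val \in unitmx }.

HB.instance Definition _ := [isSub for gl_val].
HB.instance Definition _ := [Choice of gl by <:].

Definition gl_one : gl := GLmx (unitmx1 K n).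

Lemma gl_mul_subproof (A B : gl) : gl_val A *m gl_val B \in unitmx.
Proof. by rewrite unitmx_mul !gl_unit. Qed.

Definition gl_mul (A B : gl) : gl := GLmx (gl_mul_subproof A B).

Lemma gl_inv_subproof (A : gl) : invmx (gl_val A) \in unitmx.
Proof. by rewrite unitmx_inv gl_unit. Qed.

Definition gl_inv (A : gl) : gl := GLmx (gl_inv_subproof A).

Lemma gl_mulA : associative gl_mul.
Proof. by move=> A B C; apply/val_inj; rewrite /= mulmxA. Qed.

Lemma gl_mul1 : left_id gl_one gl_mul.
Proof. by move=> A; apply/val_inj; rewrite /= mul1mx. Qed.

Lemma gl_mulr1 : right_id gl_one gl_mul.
Proof. by move=> A; apply/val_inj; rewrite /= mulmx1. Qed.

Lemma gl_mulV : left_inverse gl_one gl_inv gl_mul.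
Proof. by move=> A; apply/val_inj; rewrite /= mulVmx ?gl_unit. Qed.

Lemma gl_mulrV : right_inverse gl_one gl_inv gl_mul.
Proof. by move=> A; apply/val_inj; rewrite /= mulmxV ?gl_unit. Qed.

HB.instance Definition _ :=
  isGroup.Build gl gl_mulA gl_mul1 gl_mulr1 gl_mulV gl_mulrV.

End GeneralLinearGroup.

Section Acceptable.

Local Open Scope group_scope.

(* x ^ h is h^-1 * (x * h). *)
Definition element_conjugate (G : groupType) (H : finGroupType)
    (phi1 phi2 : {multiplicative H -> G}) : Prop :=
  forall x : H, exists h : G, phi1 x = phi2 x ^ h.

Definition globally_conjugate (G : groupType) (H : finGroupType)
    (phi1 phi2 : {multiplicative H -> G}) : Prop :=
  exists h : G, forall x : H, phi1 x = phi2 x ^ h.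

Definition acceptable (G : groupType) : Prop :=
  forall (H : finGroupType) (phi1 phi2 : {multiplicative H -> G}),
    element_conjugate phi1 phi2 -> globally_conjugate phi1 phi2.

End Acceptable.

(* Algebraic closedness is carried by the type K. *)
Definition is_algebraic_closure (F : fieldType) (K : closedFieldType)
    (iota : {rmorphism F -> K}) : Prop :=
  forall x : K, algebraicOver iota x.

(* Main.v *)
Require Import Defs.
From HB Require Import structures.
From mathcomp Require Import all_boot all_order all_fingroup all_algebra all_field.

(** The obstruction lives in a root subgroup: with E an elementary matrix off
    the diagonal, a |-> 1 + a E embeds the additive group of the field K in
    GL_n(K).  Any two nontrivial elements 1 + a E and 1 + b E are conjugate,
    by a diagonal matrix that depends on the ratio of a and b
    ([conj_transvection]); but a matrix that conjugates several such pairs at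
    once forces all their ratios to agree ([conj_transvection_ratio]).  So two
    additive maps f, g from a finite group to K that have the same kernel and
    are not proportional yield element-conjugate representations that are not
    globally conjugate ([gl_not_acceptable]).

    Such maps exist because K has positive characteristic and is bigger than
    its finite subfield F: for t in K outside F, both (1, t) and (1, t + 1)
    are linearly independent over F, so (a, b) |-> a + b t and
    (a, b) |-> a + b (t + 1) are injective on F x F; they are not
    proportional, since they both take the value 1 at (1, 0) but differ at
    (0, 1). *)

Set Implicit Arguments.
Unset Strict Implicit.
Unset Printing Implicit Defensive.

Import GRing.Theory.

Section Transvections.

Local Open Scope ring_scope.

Variables (n : nat) (K : fieldType) (i j : 'I_n).
Hypothesis ij : i != j.

Let E : 'M[K]_n := delta_mx i j.

Lemma mul_transvection (a b : K) :
  (1%:M + a *: E) *m (1%:M + b *: E) = 1%:M + (a + b) *: E.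
Proof.
rewrite mulmxDl !mulmxDr !mul1mx mulmx1 -scalemxAl -scalemxAr.
rewrite mul_delta_mx_0 1?eq_sym // !scaler0 addr0.
by rewrite scalerDl (addrC (a *: E)) addrA.
Qed.

Lemma transvection_unit (a : K) : 1%:M + a *: E \in unitmx.
Proof.
have /mulmx1_unit[] // : (1%:M + a *: E) *m (1%:M + (- a) *: E) = 1%:M.
by rewrite mul_transvection subrr scale0r addr0.
Qed.

Definition transvection (a : K) : gl n K := GLmx (transvection_unit a).

Lemma transvectionD (a b : K) :
  transvection (a + b) = (transvection a * transvection b)%g.
Proof. by apply/val_inj; rewrite /= mul_transvection. Qed.

(** Clearing the inverse turns conjugacy into a condition that is linear in
    the conjugating matrix. *)
Lemma conj_transvectionP (a b : K) (h : gl n K) :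
  transvection a = (transvection b ^ h)%g <->
  a *: (gl_val h *m E) = b *: (E *m gl_val h).
Proof.
have eqv : transvection a = (transvection b ^ h)%g <->
           (h * transvection a = transvection b * h)%g.
  split=> [-> | eq_h]; first by rewrite conjgE mulKVg.
  by rewrite conjgE -eq_h mulKg.
apply: (iff_trans eqv); split=> [/(congr1 val) | eq_h].
  rewrite /= mulmxDr mulmxDl mulmx1 mul1mx -scalemxAr -scalemxAl.
  exact: addrI.
apply/val_inj.
by rewrite /= mulmxDr mulmxDl mulmx1 mul1mx -scalemxAr -scalemxAl eq_h.
Qed.

Lemma conj_transvection (a b : K) : a != 0 -> b != 0 ->
  exists h : gl n K, transvection a = (transvection b ^ h)%g.
Proof.
move=> nz_a nz_b.
(* D E = E and E D = (a / b) E: only the entry at j meets E on the right. *)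
pose D : 'M[K]_n := diag_mx (\row_k if k == j then a / b else 1).
have unitD : D \in unitmx.
  rewrite unitmxE det_diag unitfE; apply/prodf_neq0 => k _.
  by rewrite mxE; case: ifP; rewrite ?oner_eq0 // mulf_neq0 ?invr_eq0.
exists (GLmx unitD); apply/conj_transvectionP => /=.
rewrite mul_diag_mx mul_mx_diag; apply/matrixP=> k l; rewrite !mxE.
have [-> | _] := eqVneq k i; last by rewrite !(mulr0, mul0r).
rewrite (negPf ij) mul1r.
have [_ | _] := eqVneq l j; last by rewrite !(mulr0, mul0r).
by rewrite mulr1 mul1r mulrCA mulfV // mulr1.
Qed.

(** Both conjugacies are linear relations between the same two matrices h E
    and E h; as h E is nonzero, this 2 x 2 system is singular. *)
Lemma conj_transvection_ratio (a1 b1 a2 b2 : K) (h : gl n K) :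
  transvection a1 = (transvection b1 ^ h)%g ->
  transvection a2 = (transvection b2 ^ h)%g ->
  a1 * b2 = a2 * b1.
Proof.
move=> /conj_transvectionP eq1 /conj_transvectionP eq2.
have nz_hE : gl_val h *m E != 0.
  apply/eqP=> /(congr1 (mulmx (invmx (gl_val h)))).
  rewrite mulKmx ?gl_unit // mulmx0 => /matrixP/(_ i j)/eqP.
  by rewrite !mxE !eqxx oner_eq0.
have : (a1 * b2 - a2 * b1) *: (gl_val h *m E) == 0.
  rewrite scalerBl subr_eq0 (mulrC a1) (mulrC a2) -!scalerA eq1 eq2.
  by rewrite !scalerA (mulrC b2).
by rewrite scaler_eq0 (negPf nz_hE) orbF subr_eq0 => /eqP.
Qed.

End Transvections.

Section UnipotentRepresentations.

Local Open Scope ring_scope.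

Lemma gl_not_acceptable (n : nat) (K : fieldType) (H : finGroupType)
    (f g : H -> K) (x y : H) :
    (1 < n)%N ->
    {morph f : u v / (u * v)%g >-> u + v} ->
    {morph g : u v / (u * v)%g >-> u + v} ->
    (forall u, (f u == 0) = (g u == 0)) ->
    f x * g y != f y * g x ->
  ~ acceptable (gl n K).
Proof.
move=> n_gt1 fD gD ker_fg /eqP not_prop accK.
pose i : 'I_n := Ordinal (ltnW n_gt1); pose j : 'I_n := Ordinal n_gt1.
have ij : i != j by [].
have morphT e : {morph e : u v / (u * v)%g >-> u + v} ->
    {morph (fun u : H => transvection ij (e u : K)) : u v / (u * v)%g}.
  by move=> eD u v; rewrite eD transvectionD.
pose phi : {multiplicative H -> gl n K} :=
  HB.pack (fun u => transvection ij (f u))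
    (isMultiplicative.Build _ _ _ (morphT f fD)).
pose psi : {multiplicative H -> gl n K} :=
  HB.pack (fun u => transvection ij (g u))
    (isMultiplicative.Build _ _ _ (morphT g gD)).
have [u | h conj_h] := accK H phi psi.
  have [fu0 | nz_fu] := eqVneq (f u) 0; last first.
    by apply: conj_transvection; rewrite -?ker_fg.
  have /eqP gu0 : g u == 0 by rewrite -ker_fg fu0.
  by exists 1%g; rewrite conjg1 /= fu0 gu0.
exact/not_prop/(conj_transvection_ratio (conj_h x) (conj_h y)).
Qed.

End UnipotentRepresentations.

Section FiniteSubfield.

Local Open Scope ring_scope.

(** Every element of F is a root of X^q - X, where q is the cardinality of F,
    so a root of X^q - X - 1 lies outside F. *)
Lemma closed_field_notin_finite_subfield (F : finFieldType)
    (K : closedFieldType) (iota : {rmorphism F -> K}) :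
  exists t : K, forall a, iota a != t.
Proof.
pose c k : K := (k < 2)%:R.
have [t def_t] := @solve_monicpoly K #|F| c (ltnW (finNzRing_gt1 F)).
exists t => a; apply/eqP => def_a.
have : t ^+ #|F| = 1 + t.
  rewrite def_t; case: #|F| (finNzRing_gt1 F) => [|[|m]] // _.
  rewrite !big_ord_recl big1 /= ?addr0 ?mul1r ?expr0 ?expr1 // => k _.
  by rewrite /c mul0r.
rewrite -def_a -rmorphXn /= expf_card -[LHS]add0r => /addIr/esym/eqP.
by rewrite oner_eq0.
Qed.

(** That is, 1 and t are linearly independent over F. *)
Lemma add_mul_eq0_notin_subfield (F K : fieldType) (iota : {rmorphism F -> K})
    (t : K) (a b : F) : (forall c, iota c != t) ->
  (iota a + iota b * t == 0) = (a == 0) && (b == 0).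
Proof.
move=> notFt; have [-> | nz_b] := eqVneq b 0.
  by rewrite rmorph0 mul0r addr0 fmorph_eq0 andbT.
rewrite andbF; apply: contraNF (notFt (- a / b)) => /eqP ab0.
have nz_ib : iota b != 0 by rewrite fmorph_eq0.
rewrite fmorph_div rmorphN /= -(inj_eq (mulIf nz_ib)) divfK //.
by rewrite mulrC eq_sym -addr_eq0 addrC ab0.
Qed.

End FiniteSubfield.

Theorem theorem4p3 (p f q : nat) (Fq : finFieldType) (K : closedFieldType)
    (iota : {rmorphism Fq -> K}) (n : nat)
    (p_prime : prime p) (def_q : q = p ^ f) (card_Fq : #|Fq| = q)
    (closureK : is_algebraic_closure iota)
    (q_gt5 : 5 < q) (n_gt1 : 1 < n) :
  ~ acceptable (gl n K).
Proof.
Local Open Scope ring_scope.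
have [t notFt] := closed_field_notin_finite_subfield iota.
have notFt1 c : iota c != t + 1.
  apply: contraNneq (notFt (c - 1)) => def_c.
  by rewrite rmorphB rmorph1 def_c addrK.
pose comb s (u : Fq * Fq) := iota u.1 + iota u.2 * s.
have combD s : {morph comb s : u v / (u * v)%g >-> u + v}.
  by move=> u v; rewrite /comb /= !FinRing.zmodMgE !rmorphD /= mulrDl addrACA.
apply: (@gl_not_acceptable n K _ (comb t) (comb (t + 1)) (1, 0) (0, 1)) => //.
  by move=> u; rewrite /comb !add_mul_eq0_notin_subfield.
rewrite /comb /= rmorph0 rmorph1 !(mul0r, mul1r, addr0, add0r) mulr1.
by rewrite addrC -subr_eq0 addrK oner_eq0.
Qed.
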